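(* The metabelian group $$\begin{pmatrix}1 & \mathbb Z_7\\ 0 & (\mathbb Z_7)^*\end{pmatrix}$$ of order $42$ is a minimal (by order) example of a metabelian group over which there exists a unimodular equation that has no solutions in metabelian groups. That is: over this group there exists a unimodular equation which has no solution in any metabelian group containing it; and for every metabelian group $G$ of order less than $42$, every unimodular equation over $G$ has a solution in some metabelian group containing $G$.
   Context: $\mathbb Z_7$ is the field with $7$ elements and $(\mathbb Z_7)^*$ its group of invertible elements; the displayed group is the group of all matrices $\begin{pmatrix}1&a\\0&b\end{pmatrix}$ with $a\in\mathbb Z_7$, $b\in(\mathbb Z_7)^*$ under matrix multiplication. A group is metabelian if its commutator subgroup is abelian. An equation in variables $x_1,\ldots,x_n$ over a group $G$ is an expression $w(x_1,\ldots,x_n)=1$, where $w\in G*F(x_1,\ldots,x_n)$ (free product of $G$ with the free group on $x_1,\dots,x_n$). It has a solution in a group $\tilde G\supset G$ if there are $\tilde g_1,\ldots,\tilde g_n\in\tilde G$ with $w(\tilde g_1,\ldots,\tilde g_n)=1$ in $\tilde G$. The equation is unimodular if for every prime $p$ the vector of exponent sums of $x_1,\dots,x_n$ in $w$, taken modulo $p$, is non-zero. In particular, an equation $w(x)=1$ in one variable is unimodular if and only if the exponent sum of $x$ in $w$ is $\pm1$. *)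

(* Defs.v *)
From HB Require Import structures.
From mathcomp Require Import all_boot all_order all_fingroup all_algebra.

Set Implicit Arguments.
Unset Strict Implicit.
Unset Printing Implicit Defensive.

Import GroupScope GRing.Theory.

(* Groups may be infinite, so they are taken in [groupType] rather than
   [finGroupType]; a finite group is a [finGroupType], which coerces to it. *)

Inductive derived (G : groupType) : G -> Prop :=
| derived_comm (x y : G) : derived [~ x, y]
| derived_one : derived 1
| derived_mul (x y : G) : derived x -> derived y -> derived (x * y)
| derived_inv (x : G) : derived x -> derived x^-1.

Definition metabelian (G : groupType) : Prop :=
  forall x y : G, derived x -> derived y -> commute x y.

(* An element of the free product of G and the free group on x_0, ..., x_(n-1)
   is given by a word, not necessarily reduced, in the elements of G, the
   variables and their formal inverses. Every element has such words, and
   values and exponent sums (below) do not depend on the word chosen. *)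

Inductive letter (G : groupType) (n : nat) : Type :=
| Coef of G
| Var of 'I_n
| VarInv of 'I_n.

Arguments Coef {G n} _.
Arguments Var {G n} _.
Arguments VarInv {G n} _.

Definition word (G : groupType) (n : nat) : Type := seq (letter G n).

Section Equation.

Variables (G : groupType) (n : nat).
Implicit Types (l : letter G n) (w : word G n).

Definition eval_letter (H : groupType) (f : G -> H) (h : 'I_n -> H) l : H :=
  match l with
  | Coef g => f g
  | Var i => h i
  | VarInv i => (h i)^-1
  end.

Definition eval (H : groupType) (f : G -> H) (h : 'I_n -> H) w : H :=
  \prod_(l <- w) eval_letter f h l.

Definition letter_exp (i : 'I_n) l : int :=
  match l with
  | Coef _ => 0%R
  | Var j => ((i == j)%:R)%R
  | VarInv j => (- (i == j)%:R)%R
  end.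

Definition exp_sum (i : 'I_n) w : int := (\sum_(l <- w) letter_exp i l)%R.

Definition unimodular w : Prop :=
  forall p : nat, prime p -> exists i : 'I_n, ~~ (p %| exp_sum i w)%Z.

(* An overgroup of G is a group H with an injective homomorphism G -> H. *)
Definition solvable_in_metabelian w : Prop :=
  exists (H : groupType) (f : {multiplicative G -> H}),
    [/\ metabelian H, injective f & exists h : 'I_n -> H, eval f h w = 1].

End Equation.

Definition aff7 : {set {'GL_2['F_7]}} :=
  [set u : {'GL_2['F_7]} | [exists a : 'F_7, exists b : 'F_7,
     (b \is a GRing.unit) &&
     (GLval u == (block_mx 1%:M a%:M 0 b%:M)%R :> 'M['F_7]_(1 + 1))]].

Fact aff7_group_set : group_set aff7.
Proof.
apply/group_setP; split=> [|u v].
  rewrite inE; apply/existsP; exists 0%R; apply/existsP; exists 1%R.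
  rewrite GRing.unitr1 /=; apply/eqP.
  by rewrite (raddf0 (@scalar_mx 'F_7 1)) -scalar_mx_block.
rewrite !inE => /existsP[a /existsP[b /andP[Ub /eqP Eu]]].
case/existsP=> c /existsP[d /andP[Ud /eqP Ev]].
apply/existsP; exists (c + a * d)%R; apply/existsP; exists (b * d)%R.
rewrite GRing.unitrM Ub Ud /=; apply/eqP.
transitivity ((GLval u *m GLval v)%R : 'M['F_7]_(1 + 1)); first by [].
rewrite Eu Ev (@mulmx_block _ 1 1 1 1 1 1) !mulmx0 !mul0mx !mul1mx.
by rewrite !addr0 !add0r -!scalar_mxM -raddfD.
Qed.

Canonical aff7_group : {group {'GL_2['F_7]}} := Group aff7_group_set.

(* Main.v *)
Require Import Defs.
From HB Require Import structures.
From mathcomp Require Import all_boot all_order all_fingroup all_algebra.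
From mathcomp Require Import all_solvable all_field all_character zify.

(** Over [aff7], with b of order 6 and c of order 7 such that c^b = c^3, the
    unsolvable equation is x^(b^2) (x^b)^-1 x = c: it forces x into the derived
    subgroup of a metabelian overgroup, where it says that Phi_6(b), that is
    b^2 - b + 1, sends x to c; then (b + 1) c is killed by b^3 - 1, because
    b^6 = 1, whereas b^3 = -1 on c.

    Conversely, let A be an abelian normal subgroup of G with G / A an abelian
    p-group. Embed A in a divisible abelian group D and G in the wreath product
    of D and Q = G / A. Setting all variables but one to 1, an equation becomes
    linear over Z[Q], its coefficient P having augmentation prime to p. Then P
    divides a non-zero integer in Z[Q], since P^|Q| is congruent mod p to its
    augmentation; so it acts surjectively on the functions from Q to D.

    A metabelian group of order less than 42 is a subdirect product of groups
    with such a subgroup A. Indeed, if no two non-trivial normal subgroups of G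
    meet trivially and G is not abelian, then G' is a p-group, G is the product
    of its normal Sylow p-subgroup P and of an abelian group K acting faithfully
    on P, and either K = 1 (take A = G') or, by the bound on the order, P is
    abelian and K has prime power order (take A = P). *)

Set Implicit Arguments.
Unset Strict Implicit.
Unset Printing Implicit Defensive.

Import GroupScope Order.TTheory GRing.Theory Num.Theory.

(** * Divisible abelian groups *)

(** The multiplicative group of the algebraic numbers, written additively: it is divisible because
    roots exist, and linear characters take their values in it. *)
Record algC_units := AlgCUnit { algC_unit :> algC; _ : algC_unit != 0%R }.

HB.instance Definition _ := [isSub for algC_unit].
HB.instance Definition _ := [Choice of algC_units by <:].

Lemma algC_unit_neq0 (x : algC_units) : algC_unit x != 0%R.
Proof. by case: x. Qed.

Section AlgCUnits.
Local Open Scope ring_scope.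

Definition algC_units_add (x y : algC_units) : algC_units :=
  AlgCUnit (mulf_neq0 (algC_unit_neq0 x) (algC_unit_neq0 y)).
Definition algC_units_opp (x : algC_units) : algC_units :=
  AlgCUnit (invr_neq0 (algC_unit_neq0 x)).
Definition algC_units_zero : algC_units := AlgCUnit (oner_neq0 algC).

Fact algC_units_addA : associative algC_units_add.
Proof. by move=> x y z; apply: val_inj; rewrite /= mulrA. Qed.
Fact algC_units_addC : commutative algC_units_add.
Proof. by move=> x y; apply: val_inj; rewrite /= mulrC. Qed.
Fact algC_units_add0 : left_id algC_units_zero algC_units_add.
Proof. by move=> x; apply: val_inj; rewrite /= mul1r. Qed.
Fact algC_units_addN :
  left_inverse algC_units_zero algC_units_opp algC_units_add.
Proof. by move=> x; apply: val_inj; rewrite /= mulVf ?(algC_unit_neq0 x). Qed.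

HB.instance Definition _ := GRing.isZmodule.Build algC_units
  algC_units_addA algC_units_addC algC_units_add0 algC_units_addN.

Definition divisible (D : zmodType) :=
  forall (d : int) (x : D), d != 0 -> exists y : D, y *~ d = x.

Lemma algC_units_divisible : divisible algC_units.
Proof.
move=> d x d0; have n0 : (0 < `|d|)%N by rewrite absz_gt0.
have y0 : `|d|.-root (val x) != 0 by rewrite rootC_eq0 ?(algC_unit_neq0 x).
pose y := AlgCUnit y0.
have Ey : y *+ `|d| = x.
  apply: val_inj; rewrite -[RHS](rootCK n0).
  elim: {1 3}`|d|%N => [|n IH]; first by rewrite expr0.
  by rewrite mulrS exprS -IH.
case: (intP d) d0 Ey => [||] // n _; last first.
  by exists (- y); rewrite mulrNz mulNrz opprK -pmulrn -[RHS]Ey abszN.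
by exists y; rewrite -pmulrn.
Qed.

Lemma ffun_divisible (I : finType) (D : zmodType) :
  divisible D -> divisible {ffun I -> D}.
Proof.
move=> divD d x d0.
have ex i : exists y : D, y *~ d == x i.
  by have [y <-] := divD d (x i) d0; exists y.
exists [ffun i => xchoose (ex i)]; apply/ffunP=> i.
rewrite -(eqP (xchooseP (ex i))).
suff E (z : {ffun I -> D}) : (z *~ d) i = z i *~ d by rewrite E ffunE.
have En n : (z *+ n) i = z i *+ n by rewrite ffunMnE.
by case: d {d0 ex} => n; rewrite ?NegzE ?mulrNz ?ffunE -!pmulrn En.
Qed.

(** Irreducible characters of an abelian group are linear and jointly faithful, so evaluating all of
    them embeds [A] in a power of [algC_units]. *)
Lemma abelian_embeds_divisible (gT : finGroupType) (A : {group gT}) :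
  abelian A ->
  exists (D : zmodType) (phi : gT -> D), [/\ divisible D,
    {in A &, forall x y, phi (x * y)%g = phi x + phi y}
    & forall x, x \in A -> phi x = 0 -> x = 1%g].
Proof.
move=> abA; have linA := char_abelianP _ abA.
(* Characters vanish outside [A]; the default taken there is 0, which stands for the number 1. *)
pose chi (i : Iirr A) x := insubd (0 : algC_units) ('chi[A]_i x).
have chiE i x : x \in A -> val (chi i x) = 'chi[A]_i x.
  by move=> Ax; rewrite val_insubd lin_char_neq0.
exists {ffun Iirr A -> algC_units}, (fun x => [ffun i => chi i x]); split.
- by apply: ffun_divisible; apply: algC_units_divisible.
- move=> x y Ax Ay; apply/ffunP=> i; rewrite !ffunE; apply: val_inj => /=.
  by rewrite !chiE ?groupM // lin_charM.
move=> x Ax /ffunP phi0.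
suff: x \in \bigcap_i cfker 'chi[A]_i by rewrite TI_cfker_irr => /set1P.
apply/bigcapP=> i _; rewrite cfkerEirr inE lin_char1 //.
by have:= phi0 i; rewrite !ffunE => /(congr1 val); rewrite chiE // => ->.
Qed.

End AlgCUnits.

(** * Convolution operators over the group ring of a p-group *)

Section Convolution.
Local Open Scope ring_scope.

Lemma pFrobenius_aut_sum_comm (R : nzRingType) (p : nat) (chR : p \in [pchar R])
    (I : Type) (r : seq I) (F : I -> R) :
  (forall i j, GRing.comm (F i) (F j)) ->
  pFrobenius_aut chR (\sum_(i <- r) F i) =
    \sum_(i <- r) pFrobenius_aut chR (F i).
Proof.
move=> cF; elim: r => [|i r IH]; first by rewrite !big_nil pFrobenius_aut0.
by rewrite !big_cons pFrobenius_autD_comm ?IH //; apply: commr_sum.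
Qed.

(** [B] is the matrix of multiplication by [P] on Z[Q]. Its adjugate inverts it up to the factor
    [d], its determinant, which is non-zero because it is so mod p. *)
Lemma convolution_invertible (Q : finGroupType) (p : nat) (P : Q -> int) :
    prime p -> abelian [set: Q] -> p.-group [set: Q] ->
    ~~ (p %| \sum_t P t)%Z ->
  exists (d : int) (R : Q -> Q -> int), d != 0 /\
    forall s u, \sum_v P (s * v^-1)%g * R v u = d *+ (s == u).
Proof.
move=> p_pr abQ pQ pP.
(* The order of [Q] is written as a successor, so that the square matrices form a ring. *)
have [n [e [r [eK rK]]]] : exists n (e : 'I_n.+1 -> Q) (r : Q -> 'I_n.+1),
    cancel e r /\ cancel r e.
  have Q0 : (0 < #|Q|)%N by apply/card_gt0P; exists 1%g.
  move: (@enum_val Q Q) (@enum_rank Q) (@enum_valK Q) (@enum_rankK Q).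
  by case: #|Q| Q0 => // n _ e r; exists n, e, r.
pose B : 'M[int]_n.+1 := \matrix_(i, j) P (e i * (e j)^-1)%g.
suff dB : \det B != 0.
  exists (\det B), (fun v u => \adj B (r v) (r u)); split=> // s u.
  have /matrixP/(_ (r s) (r u)) := mul_mx_adj B.
  rewrite !mxE (can_eq rK) => <-; rewrite (reindex e) /=; last first.
    by exists r => ? _; rewrite ?eK ?rK.
  by apply: eq_bigr => j _; rewrite eK [B _ _]mxE rK.
(* [T] is the regular representation of [Q] over the prime field. *)
pose T (t : Q) : 'M['F_p]_n.+1 := \matrix_(i, j) ((e i * (e j)^-1 == t)%g)%:R.
have TM t u : T (t * u)%g = T t * T u.
  apply/matrixP=> i j; rewrite !mxE (reindex r) /=; last first.
    by exists e => ? _; rewrite ?eK ?rK.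
  rewrite (bigD1 (t^-1 * e i)%g) //= big1 ?addr0 => [|v].
    rewrite !mxE rK invMg invgK mulgA mulgV mul1g eqxx mul1r.
    by rewrite -[in RHS](inj_eq (mulgI t)) !mulgA mulgV mul1g.
  move=> Nv; rewrite !mxE rK; case: eqP => [E|]; last by rewrite mul0r.
  by case/eqP: Nv; rewrite -E invMg invgK mulgKV.
have T1 : T 1%g = 1.
  by apply/matrixP=> i j; rewrite !mxE -eq_mulgV1 (can_eq eK).
have TX t k : T (t ^+ k)%g = T t ^+ k.
  by elim: k => [|k IH]; rewrite ?T1 // expgS exprS TM IH.
have chF : p \in [pchar 'F_p] by rewrite pchar_Fp.
have chM : p \in [pchar 'M['F_p]_n.+1].
  by rewrite inE p_pr -[_%:R]scaler_nat pcharf0 // scale0r eqxx.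
(* Taking p-th powers is additive, as the [T t] commute, and fixes coefficients in the prime
   field. *)
have Frob k (a : Q -> 'F_p) :
    (\sum_t a t *: T t) ^+ (p ^ k) = \sum_t a t *: T (t ^+ (p ^ k))%g.
  elim: k => [|k IH]; first by apply: eq_bigr.
  rewrite expnSr exprM {}IH -(pFrobenius_autE chM).
  rewrite pFrobenius_aut_sum_comm => [|t u]; last first.
    rewrite /GRing.comm -!scalerAl -!scalerAr -!TM (centsP abQ) ?inE //.
    by rewrite !scalerA mulrC.
  apply: eq_bigr => t _; rewrite pFrobenius_autE exprZn -TX -expgM.
  congr (_ *: _).
  have := expf_card (a t); rewrite card_Fp //.
have [k oQ] := p_natP pQ.
pose Bp := map_mx (intr : int -> 'F_p) B.
have BpE : Bp = \sum_t (P t)%:~R *: T t.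
  apply/matrixP=> i j; rewrite !mxE summxE.
  rewrite (bigD1 (e i * (e j)^-1)%g) //= big1 => [|t].
    by rewrite !mxE eqxx mulr1 addr0.
  by rewrite !mxE eq_sym => /negPf->; rewrite mulr0.
(* The exponent is |Q|, so each [t] becomes 1 and only the augmentation is left. *)
have: Bp ^+ (p ^ k) = ((\sum_t P t)%:~R)%:M.
  rewrite BpE Frob raddf_sum /= raddf_sum; apply: eq_bigr => t _.
  by rewrite -oQ expg_cardG ?inE // T1 scalemx1.
move/(congr1 determinant).
rewrite det_scalar => detB; apply: contraNneq pP => dB0.
have : \det (Bp ^+ (p ^ k)) == 0.
  have pk0 : (0 < p ^ k)%N by rewrite expn_gt0 prime_gt0.
  rewrite -(prednK pk0) exprS detM.
  by rewrite det_map_mx dB0 rmorph0 mul0r.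
by rewrite detB expf_eq0 /= -(dvdz_pcharf chF).
Qed.

End Convolution.

(** * Equations in wreath products *)

Section Wreath.
Variables (D : zmodType) (Q : finGroupType).

(** The regular wreath product: [Q] acts on the functions by translation. *)
Definition wreath : Type := ({ffun Q -> D} * Q)%type.
HB.instance Definition _ := Choice.on wreath.

Definition translate (q : Q) (m : {ffun Q -> D}) : {ffun Q -> D} :=
  [ffun s => m (q^-1 * s)].

Lemma translate1 m : translate 1 m = m.
Proof. by apply/ffunP=> s; rewrite ffunE invg1 mul1g. Qed.
Lemma translateM q r m : translate (q * r) m = translate q (translate r m).
Proof. by apply/ffunP=> s; rewrite !ffunE invMg mulgA. Qed.
Lemma translateD q m m' :
  translate q (m + m')%R = (translate q m + translate q m')%R.
Proof. by apply/ffunP=> s; rewrite !ffunE. Qed.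
Lemma translateN q m : translate q (- m)%R = (- translate q m)%R.
Proof. by apply/ffunP=> s; rewrite !ffunE. Qed.

Definition wreath_mul (x y : wreath) : wreath :=
  ((x.1 + translate x.2 y.1)%R, x.2 * y.2).
Definition wreath_one : wreath := (0%R, 1).
Definition wreath_inv (x : wreath) : wreath :=
  ((- translate x.2^-1 x.1)%R, x.2^-1).

Fact wreath_mulA : associative wreath_mul.
Proof.
move=> x y z; congr (_, _); last exact: mulgA.
by rewrite translateD translateM addrA.
Qed.
Fact wreath_mul1 : left_id wreath_one wreath_mul.
Proof. by case=> m q; congr (_, _); rewrite /= ?translate1 ?add0r ?mul1g. Qed.
Fact wreath_1mul : right_id wreath_one wreath_mul.
Proof.
case=> m q; congr (_, _); rewrite /= ?mulg1 //.
by apply/ffunP=> s; rewrite !ffunE addr0.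
Qed.
Fact wreath_mulV : left_inverse wreath_one wreath_inv wreath_mul.
Proof. by case=> m q; congr (_, _); rewrite /= ?addNr ?mulVg. Qed.
Fact wreath_Vmul : right_inverse wreath_one wreath_inv wreath_mul.
Proof.
case=> m q; congr (_, _); rewrite /= ?mulgV //.
by rewrite translateN -translateM mulgV translate1 subrr.
Qed.

HB.instance Definition _ := isGroup.Build wreath
  wreath_mulA wreath_mul1 wreath_1mul wreath_mulV wreath_Vmul.

Lemma wreath_mulE (x y : wreath) :
  x * y = ((x.1 + translate x.2 y.1)%R, x.2 * y.2) :> wreath.
Proof. by []. Qed.
Lemma wreath_invE (x : wreath) :
  x^-1 = ((- translate x.2^-1 x.1)%R, x.2^-1) :> wreath.
Proof. by []. Qed.

(** As [Q] is abelian, derived elements have trivial second component, so they lie in the abelian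
    group of functions. *)
Lemma wreath_metabelian : abelian [set: Q] -> metabelian wreath.
Proof.
move=> abQ; have cQ (q r : Q) : commute q r by apply: (centsP abQ); rewrite inE.
have der (x : wreath) : derived x -> x.2 = 1.
  elim=> [{}x y||{}x y _ Ex _ Ey|{}x _ Ex] //.
  - by change ([~ (x.2 : Q), (y.2 : Q)] = 1); apply/eqP/commgP; apply: cQ.
  - by rewrite /= Ex Ey mulg1.
  by rewrite /= Ex invg1.
move=> x y /der Ex /der Ey; rewrite /commute !wreath_mulE Ex Ey !translate1.
by rewrite addrC.
Qed.

(** The action on functions of the element of Z[Q] with coefficients [P]. *)
Definition convolve (P : {ffun Q -> int}) (m : {ffun Q -> D}) : {ffun Q -> D} :=
  [ffun s => (\sum_t m (t^-1 * s)%g *~ P t)%R].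

(** Here [e] is the augmentation of the linear coefficient [P]; the component in [Q] may not depend
    on [m]. *)
Definition affine (e : int) (F : {ffun Q -> D} -> wreath) : Prop :=
  exists (c : {ffun Q -> D}) (r : Q) (P : {ffun Q -> int}),
    (\sum_t P t)%R = e /\ forall m, F m = ((c + convolve P m)%R, r).

Lemma convolveD P P' m :
  convolve (P + P')%R m = (convolve P m + convolve P' m)%R.
Proof.
apply/ffunP=> s; rewrite !ffunE -big_split; apply: eq_bigr => t _.
by rewrite ffunE mulrzDr.
Qed.

Lemma convolveN P m : convolve (- P)%R m = (- convolve P m)%R.
Proof.
apply/ffunP=> s; rewrite !ffunE -sumrN; apply: eq_bigr => t _.
by rewrite ffunE mulrNz.
Qed.

Lemma translate_convolve q (P : {ffun Q -> int}) m :
  translate q (convolve P m) = convolve [ffun t => P (q^-1 * t)] m.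
Proof.
apply/ffunP=> s; rewrite !ffunE (reindex_inj (mulgI q^-1)) /=.
by apply: eq_bigr => t _; rewrite ffunE invMg invgK -mulgA mulKVg.
Qed.

Lemma affine_const (x : wreath) : affine 0 (fun=> x).
Proof.
exists x.1, x.2, 0%R; split=> [|m].
  by rewrite big1 // => t _; rewrite ffunE.
rewrite [X in (_ + X)%R](_ : _ = 0)%R ?addr0; first by case: x.
by apply/ffunP=> s; rewrite !ffunE big1 // => t _; rewrite ffunE.
Qed.

Lemma affine_var q : affine 1 (fun m => (m, q)).
Proof.
exists 0%R, q, [ffun t => ((t == 1%g)%:R)%R]; split=> [|m].
  rewrite (bigD1 1) //= ffunE eqxx big1 ?addr0 // => t /negPf t1.
  by rewrite ffunE t1.
congr (_, _); rewrite add0r; apply/ffunP=> s.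
rewrite ffunE (bigD1 1) //= ffunE eqxx invg1 mul1g big1 ?addr0 //.
move=> t /negPf t1.
by rewrite ffunE t1.
Qed.

Lemma affine_mul e e' F F' :
  affine e F -> affine e' F' -> affine (e + e')%R (fun m => F m * F' m).
Proof.
move=> [c [q [P [<- EF]]]] [c' [q' [P' [<- EF']]]].
exists (c + translate q c')%R, (q * q'), (P + [ffun t => P' (q^-1 * t)%g])%R.
split=> [|m].
  rewrite [(\sum_t P' t)%R](reindex_inj (mulgI q^-1)) -big_split.
  by apply: eq_bigr => t _; rewrite !ffunE.
rewrite EF EF' wreath_mulE /= translateD convolveD -translate_convolve.
by congr (_, _); rewrite addrACA.
Qed.

Lemma affine_inv e F : affine e F -> affine (- e)%R (fun m => (F m)^-1).
Proof.
move=> [c [q [P [<- EF]]]].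
exists (- translate q^-1 c)%R, q^-1, (- [ffun t => P (q^-1^-1 * t)%g])%R.
split=> [|m].
  rewrite [(\sum_t P t)%R](reindex_inj (mulgI q^-1^-1)) -sumrN.
  by apply: eq_bigr => t _; rewrite !ffunE.
by rewrite EF wreath_invE /= translateD convolveN -translate_convolve opprD.
Qed.

End Wreath.

(** * Values of words as functions of one variable *)

Lemma group_morph1 (H K : groupType) (psi : H -> K) :
  {morph psi : x y / x * y} -> psi 1 = 1.
Proof. by move=> psiM; apply: (mulgI (psi 1)); rewrite -psiM !mulg1. Qed.

Lemma group_morphV (H K : groupType) (psi : H -> K) :
  {morph psi : x y / x * y} -> {morph psi : x / x^-1}.
Proof.
by move=> psiM x; apply: (mulgI (psi x)); rewrite -psiM !mulgV group_morph1.
Qed.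

Lemma eval_morph (G H K : groupType) (n : nat) (psi : H -> K) (f : G -> H)
    (f' : G -> K) (h : 'I_n -> H) (h' : 'I_n -> K) (w : word G n) :
  {morph psi : x y / x * y} -> psi \o f =1 f' -> psi \o h =1 h' ->
  psi (eval f h w) = eval f' h' w.
Proof.
move=> psiM Ef Eh; rewrite /eval (big_morph psi psiM (group_morph1 psiM)).
by apply: eq_bigr => -[g|j|j] _ /=; rewrite ?group_morphV -?Ef -?Eh.
Qed.

(* [K e F] means that F has degree e in the variable of index i, the only one
   that is not set to 1. *)
Lemma eval_graded_ind (T : Type) (H : groupType) (K : int -> (T -> H) -> Prop)
    (v : T -> H) (G : groupType) (n : nat) (f : G -> H) (i : 'I_n) :
    (forall e F F', F =1 F' -> K e F -> K e F') ->
    (forall x, K 0%R (fun=> x)) -> K 1%R v ->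
    (forall e e' F F', K e F -> K e' F' ->
       K (e + e')%R (fun t => F t * F' t)) ->
    (forall e F, K e F -> K (- e)%R (fun t => (F t)^-1)) ->
  forall w : word G n,
    K (exp_sum i w) (fun t => eval f (fun j => if i == j then v t else 1) w).
Proof.
move=> Kext Kconst Kvar Kmul Kinv w; rewrite /exp_sum /eval.
elim: w => [|l w IH].
  by rewrite big_nil; apply: Kext (Kconst 1) => t; rewrite big_nil.
rewrite big_cons.
suff Kl : K (letter_exp i l)
    (fun t => eval_letter f (fun j => if i == j then v t else 1) l).
  by apply: Kext (Kmul _ _ _ _ Kl IH) => t; rewrite big_cons.
case: l => [g|j|j] /=; first exact: Kconst.
  by case: eqP => _; [apply: Kvar | apply: Kconst].
by case: eqP => _; apply: Kinv; [apply: Kvar | apply: Kconst].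
Qed.

(** The linear coefficient is the image in Z[Q] of the Fox derivative of [w] in the variable [i];
    its augmentation is the exponent sum. *)
Lemma affine_eval (D : zmodType) (Q : finGroupType) (G : groupType) (n : nat)
    (f : G -> wreath D Q) (i : 'I_n) (q : Q) (w : word G n) :
  affine (exp_sum i w)
    (fun m => eval f (fun j => if i == j then (m, q) : wreath D Q else 1) w).
Proof.
apply: eval_graded_ind.
- move=> e F F' EF [c [r [P [EP H]]]]; exists c, r, P; split=> // m.
  by rewrite -EF.
- exact: affine_const.
- exact: affine_var.
- exact: affine_mul.
exact: affine_inv.
Qed.

(* Kaloujnine--Krasner embedding *)
Lemma embeds_wreath (gT : finGroupType) (A : {group gT}) (D : zmodType)
    (phi : gT -> D) :
    A <| [set: gT] ->
    {in A &, forall x y, phi (x * y) = (phi x + phi y)%R} ->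
    (forall x, x \in A -> phi x = 0%R -> x = 1) ->
  exists f : gT -> wreath D (coset_of A),
    {morph f : x y / x * y} /\ injective f.
Proof.
move=> nsA phiM phi0.
have N z : z \in 'N(A) by rewrite (subsetP (normal_norm nsA)) ?inE.
have cM x y : coset A (x * y) = coset A x * coset A y by rewrite morphM.
have cV x : coset A x^-1 = (coset A x)^-1 by rewrite morphV.
(* The elements [repr s] form a transversal, which [g] preserves only up to this factor in [A]. *)
pose cocycle (g : gT) (s : coset_of A) : gT :=
  (repr s)^-1 * (g * repr ((coset A g)^-1 * s)).
have cocycleA g s : cocycle g s \in A.
  by apply: coset_idr => //; rewrite !cM cV !coset_reprK mulKVg mulVg.
pose f (g : gT) : wreath D (coset_of A) :=
  ([ffun s => phi (cocycle g s)], coset A g).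
have fM : {morph f : x y / x * y}.
  move=> x y; rewrite /f wreath_mulE /= cM; congr (_, _); apply/ffunP=> s.
  rewrite !ffunE -phiM //; congr phi; rewrite /cocycle cM invMg.
  by rewrite -!mulgA mulKVg.
exists f; split=> // x y Exy.
have Exy1 : f (x^-1 * y) = f 1.
  by apply: (mulgI (f x)); rewrite -!fM mulKVg mulg1.
set z := x^-1 * y in Exy1.
suff z1 : z = 1 by rewrite -[y](mulKVg x) -/z z1 mulg1.
have f1 : f 1 = 1 by apply: (mulgI (f 1)); rewrite -fM !mulg1.
(* An element [z] of the kernel lies in [A]; as [repr 1] is 1, the coordinate of its image at the
   coset 1 is [phi z]. *)
move: Exy1; rewrite f1 => -[/ffunP/(_ 1)].
rewrite !ffunE /cocycle => + cz1.
rewrite cz1 repr_coset1 !invg1 !mul1g repr_coset1 mulg1.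
by apply: phi0; apply: coset_idr.
Qed.

(* The exponent k is only congruent to e mod p, so that it can be natural. *)
Definition monomial (Q : finGroupType) (p : nat) (e : int) (F : Q -> Q) :
    Prop :=
  exists (c : Q) (k : nat), (p %| (k%:Z - e)%R)%Z /\ forall q, F q = c * q ^+ k.

(** [k] is prime to p, so taking k-th powers permutes the p-group [Q]; [expg_invn] gives the inverse
    exponent. *)
Lemma monomial_surj (Q : finGroupType) (p : nat) (e : int) (F : Q -> Q) :
  prime p -> p.-group [set: Q] -> ~~ (p %| e)%Z -> monomial p e F ->
  exists q, F q = 1.
Proof.
move=> p_pr pQ pe [c [k [ke EF]]].
have coQk : coprime #|[set: Q]%G| k.
  have [j ->] := p_natP pQ; rewrite coprimeXl // prime_coprime //.
  by apply: contra pe => pk; rewrite -[e](subKr k%:Z) rpredB.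
by exists (c^-1 ^+ expg_invn [set: Q] k); rewrite EF expgAC expgK ?inE // mulgV.
Qed.

Lemma monomial_eval (Q : finGroupType) (p : nat) (G : groupType) (n : nat)
    (f : G -> Q) (i : 'I_n) (w : word G n) :
  prime p -> abelian [set: Q] ->
  monomial p (exp_sum i w)
    (fun q => eval f (fun j => if i == j then q else 1) w).
Proof.
move=> p_pr abQ.
have cQ (q r : Q) : commute q r by apply: (centsP abQ); rewrite inE.
have const (c : Q) : monomial p 0 (fun=> c).
  by exists c, 0; split=> // q; rewrite mulg1.
have mul e e' (F F' : Q -> Q) : monomial p e F -> monomial p e' F' ->
    monomial p (e + e')%R (fun q => F q * F' q).
  move=> [c [k [ke EF]]] [c' [k' [ke' EF']]].
  exists (c * c'), (k + k'); split=> [|q].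
    by rewrite PoszD opprD addrACA rpredD.
  by rewrite EF EF' expgD !mulgA; congr (_ * _); rewrite -!mulgA [_ * c']cQ.
have inv e (F : Q -> Q) :
    monomial p e F -> monomial p (- e)%R (fun q => (F q)^-1).
  move=> [c [k [ke EF]]].
  (* This natural exponent is congruent to -k both mod |Q|, for the values in [Q], and mod p, for
     the degree. *)
  exists c^-1, (k * (#|[set: Q]%G| * p).-1)%N; split=> [|q].
    have N0 : (0 < #|[set: Q]%G| * p)%N by rewrite muln_gt0 cardG_gt0 prime_gt0.
    have -> : (Posz (k * (#|[set: Q]%G| * p).-1)%N - - e =
        Posz (k * #|[set: Q]%G| * p)%N - (k%:Z - e))%R.
      rewrite -mulnA -{2}(prednK N0) mulnS PoszD opprB opprK.
      by rewrite [RHS]addrC addrA addrNK addrC.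
    by rewrite rpredB // dvdzE dvdn_mull.
  rewrite EF; apply: (mulgI (c * q ^+ k)); rewrite mulgV.
  rewrite [c^-1 * _]cQ mulgA -[c * _ * _]mulgA -expgD; apply/esym.
  have -> : (k + k * (#|[set: Q]%G| * p).-1 = #|[set: Q]%G| * (p * k))%N.
    by rewrite -mulnS prednK ?muln_gt0 ?cardG_gt0 ?prime_gt0 // mulnC mulnA.
  by rewrite expgM expg_cardG ?inE // expg1n mulg1 mulgV.
have var : monomial p 1 (id : Q -> Q).
  by exists 1, 1%N; split=> // q; rewrite mul1g.
apply: eval_graded_ind => //.
by move=> e F F' EF [c [k [ke H]]]; exists c, k; split=> // q; rewrite -EF.
Qed.

(** Two stages: first the image of the equation in [Q] is solved by [q]; then an affine equation for
    [m] is left, whose coefficient divides an integer [d], and [D] is divisible. *)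
Lemma solvable_of_prime_power_quotient (G : finGroupType) (A : {group G})
    (p n : nat) (w : word G n) :
    prime p -> A <| [set: G] -> abelian A -> abelian ([set: G] / A) ->
    p.-group ([set: G] / A) -> unimodular w ->
  solvable_in_metabelian w.
Proof.
move=> p_pr nsA abA; set Q := coset_of A.
have -> : [set: G] / A = [set: Q].
  apply/setP=> x; rewrite !inE -[x]coset_reprK mem_quotient ?inE //.
move=> abQ pQ /(_ p p_pr)[i pe].
have [D [phi [divD phiM phi0]]] := abelian_embeds_divisible abA.
have [f [fM finj]] := embeds_wreath nsA phiM phi0.
pose fm : {multiplicative G -> wreath D Q} :=
  HB.pack f (isMultiplicative.Build G (wreath D Q) f fM).
exists (wreath D Q), fm; split=> //; first exact: wreath_metabelian.
pose h m q (j : 'I_n) : wreath D Q := if i == j then (m, q) : wreath D Q else 1.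
have [q Eq] : exists q,
    eval (fun g => (fm g).2) (fun j => if i == j then q else 1) w = 1.
  exact/(monomial_surj p_pr pQ pe)/monomial_eval.
have [c [r [P [EP H]]]] := affine_eval fm i q w.
have Er : r = 1.
  rewrite -Eq; transitivity (eval fm (h 0%R q) w).2; first by rewrite H.
  apply: (@eval_morph _ _ _ _ (snd : wreath D Q -> Q)) => // j.
  by rewrite /h /=; case: eqP.
rewrite -EP in pe.
have [d [R [d0 RP]]] := convolution_invertible p_pr abQ pQ pe.
(* [m0] is -c divided by [d], and [m] is [R] applied to [m0]; hence [P] sends [m] to d m0 = -c. *)
have ex s : exists x : D, (x *~ d == - c s)%R.
  by have [x <-] := divD d (- c s)%R d0; exists x.
pose m0 s := xchoose (ex s).
pose m := [ffun s => (\sum_u m0 u *~ R s u)%R].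
exists (h m q).
rewrite H Er; congr (_, _); apply/ffunP=> s; rewrite !ffunE.
apply/eqP; rewrite addrC addr_eq0 -(eqP (xchooseP (ex s))) -/(m0 s); apply/eqP.
(* The index t is replaced by s v^-1, to match [RP]. *)
rewrite (reindex_inj (inj_comp (mulgI s) invg_inj)) /=.
transitivity (\sum_v \sum_u m0 u *~ (P (s * v^-1)%g * R v u))%R.
  apply: eq_bigr => v _; rewrite ffunE invMg invgK mulgKV mulrz_suml.
  by apply: eq_bigr => u _; rewrite -mulrzA mulrC.
rewrite exchange_big (bigD1 s) //= -mulrz_sumr RP eqxx.
rewrite big1 ?addr0 // => u us.
by rewrite -mulrz_sumr RP eq_sym (negPf us).
Qed.

(** * The group of order 42 *)

Section Aff7.
Local Open Scope ring_scope.

Definition affmx (a b : 'F_7) : 'M['F_7]_(1 + 1) := block_mx 1%:M a%:M 0 b%:M.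

Lemma affmxM a b c d : affmx a b *m affmx c d = affmx (c + a * d) (b * d).
Proof.
rewrite (@mulmx_block _ 1 1 1 1 1 1) !mulmx0 !mul0mx !mul1mx.
by rewrite !addr0 !add0r -!scalar_mxM -raddfD.
Qed.

Notation aff7T := (subg_of aff7_group).

Definition aff_shift (x : aff7T) : 'F_7 :=
  (GLval (sgval x) : 'M_(1 + 1)) (lshift 1 0) (rshift 1 0).
Definition aff_scale (x : aff7T) : 'F_7 :=
  (GLval (sgval x) : 'M_(1 + 1)) (rshift 1 0) (rshift 1 0).

Lemma aff_coordP (x : aff7T) :
  aff_scale x != 0 /\ GLval (sgval x) = affmx (aff_shift x) (aff_scale x).
Proof.
have := subgP x; rewrite inE => /existsP[a /existsP[b /andP[Ub /eqP E]]].
rewrite /aff_shift /aff_scale E block_mxEur block_mxEdr !mxE eqxx !mulr1n.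
by rewrite -unitfE.
Qed.

Lemma aff_coord_uniq (x y : aff7T) :
  aff_shift x = aff_shift y -> aff_scale x = aff_scale y -> x = y.
Proof.
move=> Es Eb; apply/val_inj/val_inj.
by rewrite [LHS](aff_coordP x).2 [RHS](aff_coordP y).2 Es Eb.
Qed.

Lemma affmx_inj a b c d : affmx a b = affmx c d -> a = c /\ b = d.
Proof.
move/eq_block_mx=> [_ /matrixP/(_ 0 0) + _ /matrixP/(_ 0 0)].
by rewrite !mxE !eqxx !mulr1n.
Qed.

Lemma aff_coordM (x y : aff7T) :
  aff_shift (x * y)%g = aff_shift y + aff_shift x * aff_scale y /\
  aff_scale (x * y)%g = aff_scale x * aff_scale y.
Proof.
apply: affmx_inj; rewrite -(aff_coordP (x * y)%g).2 -affmxM.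
by rewrite -(aff_coordP x).2 -(aff_coordP y).2.
Qed.

Lemma aff_coord_surj a b : b != 0 ->
  exists x : aff7T, aff_shift x = a /\ aff_scale x = b.
Proof.
move=> b0.
have U : (affmx a b : 'M_2) \is a GRing.unit.
  rewrite -[_ \is a _]/(affmx a b \in unitmx) unitmxE det_ublock.
  by rewrite !det_scalar1 mul1r unitfE.
pose u : {'GL_2['F_7]} := FinRing.unit _ U.
have Au : u \in aff7_group.
  rewrite inE; apply/existsP; exists a; apply/existsP; exists b.
  by rewrite unitfE b0 /=.
exists (subg aff7_group u); apply: affmx_inj.
by rewrite -(aff_coordP _).2 subgK.
Qed.

Lemma card_aff7 : #|aff7T| = 42.
Proof.
pose coord (x : aff7T) := (aff_shift x, aff_scale x).
have inj : injective coord by move=> x y [? ?]; apply: aff_coord_uniq.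
rewrite -(card_codom inj).
rewrite (eq_card (_ : _ =i setX [set: 'F_7] [set~ 0])).
  by rewrite cardsX cardsT cardsC1 card_Fp.
move=> [a b]; rewrite !inE /=; apply/codomP/idP => [[x [_ ->]]|].
  exact: (aff_coordP x).1.
by case/(aff_coord_surj a) => x [Ea Eb]; exists x; rewrite /coord Ea Eb.
Qed.

Lemma aff_coord1 : aff_shift 1%g = 0 /\ aff_scale 1%g = 1.
Proof.
apply: affmx_inj; rewrite -(aff_coordP 1%g).2.
by rewrite /affmx (raddf0 (@scalar_mx 'F_7 1)) -scalar_mx_block.
Qed.

Lemma aff_scaleV (x : aff7T) : aff_scale x^-1%g = (aff_scale x)^-1.
Proof.
have [s0 _] := aff_coordP x; apply: (mulfI s0).
by rewrite -(aff_coordM _ _).2 mulgV aff_coord1.2 divff.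
Qed.

Lemma aff_shiftV (x : aff7T) :
  aff_shift x^-1%g = - (aff_shift x / aff_scale x).
Proof.
apply/eqP; rewrite -addr_eq0 -aff_scaleV -(aff_coordM x x^-1%g).1.
by rewrite mulgV aff_coord1.1.
Qed.

Lemma aff_scale_comm (x y : aff7T) : aff_scale [~ x, y]%g = 1.
Proof.
have [[x0 _] [y0 _]] := (aff_coordP x, aff_coordP y).
rewrite !(aff_coordM _ _).2 !aff_scaleV [aff_scale x * _]mulrC.
by rewrite mulKf // mulVf.
Qed.

Lemma aff_scale_derived (x : aff7T) : derived x -> aff_scale x = 1.
Proof.
elim=> [y z||y z _ Ey _ Ez|y _ Ey].
- exact: aff_scale_comm.
- exact: aff_coord1.2.
- by rewrite (aff_coordM _ _).2 Ey Ez mulr1.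
by rewrite aff_scaleV Ey invr1.
Qed.

(** Derived elements have scale 1: they are translations, and these commute. *)
Lemma aff7_metabelian : metabelian aff7T.
Proof.
move=> x y /aff_scale_derived Ex /aff_scale_derived Ey.
apply: aff_coord_uniq; rewrite ?(aff_coordM _ _).1 ?(aff_coordM _ _).2 Ex Ey //.
by rewrite !mulr1 addrC.
Qed.

End Aff7.

(** * The unsolvable equation *)

Lemma derived_conj (H : groupType) (x y : H) : derived x -> derived (x ^ y).
Proof.
move=> dx; suff -> : x ^ y = x * [~ x, y].
  by apply: derived_mul (derived_comm _ _).
by rewrite commgEl mulKVg.
Qed.

Lemma morph_derived (G H : groupType) (f : G -> H) (x : G) :
  {morph f : x y / x * y} -> derived x -> derived (f x).
Proof.
move=> fM; have fV := group_morphV fM; elim=> [y z||y z _ dy _ dz|y _ dy].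
- by rewrite !(fM, fV); apply: derived_comm.
- by rewrite (group_morph1 fM); apply: derived_one.
- by rewrite fM; apply: derived_mul.
by rewrite fV; apply: derived_inv.
Qed.

(** Additively, with [b] acting by conjugation, (b^2 - b + 1) x = c. Applying b + 1 gives (b^3 + 1)
    x = 4c, which b^3 fixes since b^6 = 1; but b^3 sends 4c to 108c = 3c, so c = 0. *)
Lemma Phi6_equation (H : groupType) (b c x : H) :
    metabelian H -> derived c -> c ^ b = c ^+ 3 -> c ^+ 7 = 1 -> b ^+ 6 = 1 ->
  x ^ (b ^+ 2) * (x ^ b)^-1 * x = c -> c = 1.
Proof.
move=> mH dc cb c7 b6 Ex.
have dx : derived x.
  (* Conjugation is trivial modulo the derived subgroup, where the equation thus reads x = c = 1. *)
  have xJ z : exists2 u, derived u & x ^ z = x * u.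
    by exists [~ x, z]; [apply: derived_comm | rewrite commgEl mulKVg].
  have [[u du Eu] [v dv Ev]] := (xJ b, xJ (b ^+ 2)).
  have -> : x = c * u * v^-1 by rewrite -Ex Ev Eu invMg !mulgA !mulgKV mulgK.
  by do 2?apply: derived_mul => //; apply: derived_inv.
have [y yE] : exists y : nat -> H, forall k, y k = x ^ (b ^+ k) by eexists.
have yJ k : y k ^ b = y k.+1 by rewrite !yE -conjgM expgSr.
have cy j k : commute (y j) (y k).
  by rewrite !yE; apply: mH; apply: derived_conj.
have Ec : y 2 * (y 1%N)^-1 * y 0%N = c by rewrite !yE expg0 conjg1.
have Ecb : y 3 * (y 2)^-1 * y 1%N = c ^+ 3.
  by rewrite -cb -Ec !conjMg conjVg !yJ.
(* (b + 1)(b^2 - b + 1) = b^3 + 1, and b + 1 multiplies c by 3 + 1. *)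
have E30 : y 3 * y 0%N = c ^+ 4.
  rewrite expgSr -Ecb -Ec.
  by rewrite !mulgA -(mulgA _ (y 1%N)) (cy 1%N 2) !mulgA mulgKV mulgK.
have b3 : b ^+ 3 = b * b * b by rewrite -mulgA.
have cbk : c ^ (b ^+ 3) = c ^+ 27 by rewrite b3 !conjgM !(cb, conjXg) -!expgM.
(* b^3 exchanges [y 0] and [y 3], because [y 6] is [y 0]. *)
have : (c ^+ 4) ^ (b ^+ 3) = c ^+ 4.
  have y6 : y 6 = y 0%N by rewrite !yE b6.
  have yMJ j k : (y j * y k) ^ b = y j.+1 * y k.+1 by rewrite conjMg !yJ.
  by rewrite -E30 b3 !conjgM !yMJ y6 cy.
rewrite conjXg cbk -expgM (_ : (27 * 4 = 7 * 15 + 3)%N) // expgD expgM.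
rewrite c7 expg1n mul1g.
by rewrite [RHS]expgSr -[LHS]mulg1 => /mulgI.
Qed.

(** The word x^(b^2) (x^b)^-1 x c^-1 with its conjugates expanded; the exponent sum is 1 - 1 + 1. *)
Definition Phi6_word (G : groupType) (b c : G) : word G 1 :=
  [:: Coef (b ^- 2); Var ord0; Coef (b ^+ 2);
      Coef b^-1; VarInv ord0; Coef b; Var ord0; Coef c^-1].

Lemma Phi6_word_unimodular (G : groupType) (b c : G) :
  unimodular (Phi6_word b c).
Proof.
move=> p p_pr; exists ord0; rewrite /exp_sum !big_cons big_nil /=.
by rewrite [X in (_ %| X)%Z](_ : _ = 1)%R // dvdz1 neq_ltn prime_gt1 ?orbT.
Qed.

Lemma Phi6_word_unsolvable (G : groupType) (b c : G) :
    derived c -> c ^ b = c ^+ 3 -> c ^+ 7 = 1 -> b ^+ 6 = 1 -> c != 1 ->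
  ~ solvable_in_metabelian (Phi6_word b c).
Proof.
move=> dc cb c7 b6 c1 [H [f [mH finj [h]]]].
have fM : {morph f : x y / x * y} by apply: gmulfM.
have [f1 fV] := (group_morph1 fM, group_morphV fM).
have fX x k : f (x ^+ k) = f x ^+ k.
  by elim: k => [|k IH]; rewrite ?f1 // !expgS fM IH.
rewrite /eval !big_cons big_nil /= !fV !fX mulg1 => E.
case/eqP: c1; apply: finj; rewrite f1.
apply: (@Phi6_equation _ (f b) _ (h ord0)) => //.
- exact: morph_derived.
- by rewrite /conjg -fV -!fM -fX -cb.
- by rewrite -fX c7.
- by rewrite -fX b6.
by apply: (mulIg (f c)^-1); rewrite mulgV -E /conjg !invMg invgK !mulgA.
Qed.

Lemma aff7_unsolvable : exists (n : nat) (w : word [subg aff7_group]%type n),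
  unimodular w /\ ~ solvable_in_metabelian w.
Proof.
have [c0 [sc0 bc0]] := aff_coord_surj 1%R (oner_neq0 _).
(* 3 is a primitive root mod 7: this diagonal matrix has order 6, and conjugation by it cubes
   translations. *)
have [|b [sb bb]] := @aff_coord_surj 0%R 3%:R%R; first by [].
have d : derived [~ c0, b] by apply: derived_comm.
have bc := aff_scale_derived d.
(* Conjugation by [b] takes the shift of [c0] from 1 to 3, so the commutator has shift 3 - 1. *)
have sc : aff_shift [~ c0, b] = 2%:R%R.
  rewrite !((aff_coordM _ _).1, (aff_coordM _ _).2) !(aff_shiftV, aff_scaleV).
  by rewrite sc0 bc0 sb bb; apply/val_inj.
move: [~ c0, b] d bc sc => c d bc sc.
have E x y : aff_shift x = aff_shift y /\ aff_scale x = aff_scale y -> x = y.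
  by case; apply: aff_coord_uniq.
have [one_s one_b] := aff_coord1.
exists 1%N, (Phi6_word b c); split; first exact: Phi6_word_unimodular.
apply: Phi6_word_unsolvable => //.
- apply: E; rewrite !expgSr expg0 mul1g.
  rewrite !((aff_coordM _ _).1, (aff_coordM _ _).2, aff_shiftV, aff_scaleV).
  by rewrite sc bc sb bb; split; apply/val_inj.
- apply: E; rewrite !expgSr expg0 mul1g one_s one_b.
  by rewrite !((aff_coordM _ _).1, (aff_coordM _ _).2) sc bc; split;
     apply/val_inj.
- apply: E; rewrite !expgSr expg0 mul1g one_s one_b.
  by rewrite !((aff_coordM _ _).1, (aff_coordM _ _).2) sb bb; split;
     apply/val_inj.
by apply/eqP=> /(congr1 aff_shift); rewrite sc one_s.
Qed.

(** * Metabelian groups of order less than 42 *)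

(** The quotient of [K] by ['C_K(X)] embeds in the automorphism group of the cyclic group [X], of
    order |X| - 1. *)
Lemma index_cent_dvdn_pred (gT : finGroupType) (X K : {group gT}) :
  prime #|X| -> K \subset 'N(X) -> #|K : 'C_K(X)| %| #|X|.-1.
Proof.
move=> pX nXK; rewrite -totient_prime // -(card_Aut_cyclic (prime_cyclic pX)).
have := cardSg (Aut_conj_aut X K); apply: dvdn_trans.
by rewrite card_morphim ker_conj_aut (setIidPr nXK) indexgI.
Qed.

Lemma cent_card2 (gT : finGroupType) (X K : {group gT}) :
  #|X| = 2 -> K \subset 'N(X) -> K \subset 'C(X).
Proof.
move=> oX nXK; have := @index_cent_dvdn_pred _ X K; rewrite oX => /(_ isT nXK).
by rewrite dvdn1 indexg_eq1 subsetI subxx.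
Qed.

(** For the orders of a normal Sylow subgroup and its complement. The bound is sharp: m = 7 and k =
    6 satisfy all the other hypotheses. *)
Lemma prime_power_quotient_arith (m k : nat) :
  1 < m -> 1 < k -> m * k < 42 -> coprime m k -> (prime m -> k %| m.-1) ->
  (pdiv k).-nat k.
Proof.
move=> m1 k1 mk cmk mpr.
(* Each factor is at least 2, so both are below 21 and finitely many cases remain. *)
have bound : all (fun k => all (fun m =>
    [|| m < 2, k < 2, 42 <= m * k, ~~ coprime m k,
        prime m && ~~ (k %| m.-1) | (pdiv k).-nat k])
    (iota 0 21)) (iota 0 21).
  by vm_compute.
have lk : k < 21.
  by rewrite -(ltn_pmul2l (isT : 0 < 2)) (leq_ltn_trans _ mk) //
    leq_mul2r m1 orbT.
have lm : m < 21.
  by rewrite -(ltn_pmul2r (isT : 0 < 2)) (leq_ltn_trans _ mk) //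
    leq_mul2l k1 orbT.
have := allP bound k; rewrite mem_iota lk => /(_ isT)/allP/(_ m).
rewrite mem_iota lm => /(_ isT).
rewrite ltnNge m1 ltnNge k1 leqNgt mk cmk /= => /orP[/andP[/mpr ->]|] //.
Qed.

(** [K] acts trivially on [P / D], and by coprimeness fixed points there lift to fixed points in
    [P]. *)
Lemma coprime_cent_mul_sub (gT : finGroupType) (P D K : {group gT}) :
    K \subset 'N(P) -> K \subset 'N(D) -> D <| P -> [~: P, K] \subset D ->
    coprime #|P| #|K| -> solvable P ->
  'C_P(K) * D = P.
Proof.
move=> nPK nDK /andP[sDP nDP] sPKD coPK solP.
apply/eqP; rewrite eqEsubset mul_subG ?subsetIl //=.
rewrite (normC (subset_trans (subsetIl P _) nDP)).
rewrite -quotientSK //.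
rewrite coprime_quotient_cent ?(coprimeSg sDP) // subsetI subxx /=.
by rewrite quotient_cents2r.
Qed.

(** A prime power below 21 with exponent at least 3 is 8 or 16, and 16 would leave only k = 2, not
    coprime to it. *)
Lemma eq8_of_mul_lt42 (p m k : nat) :
    prime p -> p.-nat m -> 2 < logn p m -> 1 < k -> m * k < 42 -> coprime m k ->
  m = 8.
Proof.
move=> p_pr /p_natP[a ->]; rewrite pfactorK // => a2 k1 mk cmk.
have m20 : p ^ a < 21.
  rewrite -(ltn_pmul2r (isT : 0 < 2)) (leq_ltn_trans _ mk) //.
  by rewrite leq_mul2l k1 orbT.
have p2 : p = 2.
  apply/eqP; rewrite eqn_leq prime_gt1 // andbT leqNgt; apply/negP=> p3.
  have: 3 ^ 3 <= 3 ^ a by rewrite leq_exp2l.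
  rewrite leqNgt (leq_ltn_trans _ (leq_trans m20 _)) //.
  by rewrite leq_exp2r // (ltn_trans _ a2).
move: a2 m20 mk cmk; rewrite p2; case: a => [|[|[|[|[|a]]]]] // _.
  by case: k k1 => [|[|[|k]]] // _; rewrite -?[2 ^ 4]/16 => //; lia.
by rewrite ltnNge !expnS => /negP[]; have := expn_gt0 2 a; lia.
Qed.

(** By coprime action, P = C_P(K) D and D = C_D(K) [D, K]. The centre of [P] has order 2, so it lies
    in C_D(K); as |D| is at most 4, [D, K] has order at most 2 and is centralized too. *)
Lemma nonabelian_card8 (gT : finGroupType) (P D K : {group gT}) :
    #|P| = 8 -> ~~ abelian P -> D <| P -> abelian D -> D :!=: 1 ->
    [~: P, K] \subset D -> K \subset 'N(P) -> K \subset 'N(D) ->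
    coprime #|P| #|K| ->
  K \subset 'C(P).
Proof.
move=> oP abP nsDP abD D1 sPKD nPK nDK coPK.
have pP : 2.-group P by rewrite /pgroup oP.
have nilP := pgroup_nil pP.
have sDP := normal_sub nsDP.
have coDK := coprimeSg sDP coPK.
have oD : #|D| <= 4.
  have : D \proper P.
    by rewrite properEneq sDP andbT; apply: contraNneq abP => <-.
  move/proper_card; rewrite oP => lD; have := cardSg sDP; rewrite oP.
  by move: #|D| lD; do 8?case=> //.
have oZ : #|'Z(P)| = 2.
  have Z1 : 'Z(P) != 1 by rewrite center_nil_eq1 // -cardG_gt1 oP.
  move: Z1; rewrite -cardG_gt1.
  have iZ : (#|P / 'Z(P)| * #|'Z(P)|)%N = 8.
    by rewrite card_quotient ?gFnorm // mulnC Lagrange ?center_sub.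
  (* [P / 'Z(P)] is not cyclic, hence has order at least 3, which bounds the centre since 3 * 3 >
     8. *)
  have : 2 < #|P / 'Z(P)|.
    rewrite ltnNge; apply: contra abP => le2.
    apply: cyclic_center_factor_abelian.
    case E: #|P / 'Z(P)| le2 => [|[|[|//]]] _.
    - by have := cardG_gt0 (P / 'Z(P)); rewrite E.
    - by rewrite (card1_trivg E) cyclic1.
    by apply: prime_cyclic; rewrite E.
  move=> q2 z1; apply/eqP; rewrite eqn_leq z1 andbT.
  rewrite -ltnS -(ltn_pmul2l (isT : 0 < 3)).
  by rewrite (leq_ltn_trans _ (_ : 8 < _)) // -iZ leq_mul2r q2 orbT.
(* A non-trivial normal subgroup of a nilpotent group meets the centre, here of prime order. *)
have sZD : 'Z(P) \subset D.
  apply: prime_meetG; first by rewrite oZ.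
  by rewrite setIC; apply: meet_center_nil.
have cZK : K \subset 'C('Z(P)) by apply: cent_card2 => //; apply: gFnorm_trans.
have solP := nilpotent_sol nilP.
have solD := solvableS sDP solP.
have nRK : K \subset 'N([~: D, K]) by rewrite commg_normr.
have sRD : [~: D, K] \subset D by rewrite commg_subl.
have nsRD : [~: D, K] <| D by rewrite /normal sRD sub_abelian_norm.
have DE : 'C_D(K) * [~: D, K] = D by apply: coprime_cent_mul_sub.
have PE : 'C_P(K) * D = P by apply: coprime_cent_mul_sub.
suff cDK : D \subset 'C(K) by rewrite centsC -PE mul_subG ?subsetIr.
rewrite -DE mul_subG ?subsetIr //.
have cTI : 'C_[~: D, K](K) = 1 by apply: coprime_abel_cent_TI.
rewrite centsC; have [-> | R1] := eqVneq [~: D, K] 1; first exact: cents1.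
apply: cent_card2 => //.
have : (#|'C_D(K)| * #|[~: D, K]|)%N = #|D|.
  rewrite -[in RHS]DE TI_cardMg //; apply/trivgP.
  by rewrite -cTI setIC setISS ?subsetIr //.
have : 1 < #|'C_D(K)|.
  apply: leq_trans (subset_leq_card (_ : 'Z(P) \subset _)); first by rewrite oZ.
  by rewrite subsetI sZD centsC.
move: R1; rewrite -cardG_gt1; move: oD.
move=> le4 r1 c1 E; apply/eqP; rewrite eqn_leq r1 andbT.
rewrite -(leq_pmul2l (isT : 0 < 2)) (leq_trans _ le4) //.
by rewrite -E leq_mul2r c1 orbT.
Qed.

Lemma abelian_by_prime_power (gT : finGroupType) (G : {group gT}) :
    abelian G^`(1) -> #|G| < 42 ->
    (forall N1 N2 : {group gT}, N1 <| G -> N2 <| G -> N1 :&: N2 = 1 ->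
       N1 :=: 1 \/ N2 :=: 1) ->
  exists (A : {group gT}) (p : nat),
    [/\ prime p, A <| G, abelian A, abelian (G / A) & p.-group (G / A)].
Proof.
move=> abD ltG mono; pose D := G^`(1)%G.
have [D1|D1] := eqVneq (D : {set gT}) 1.
  exists G, 2; rewrite trivg_quotient abelian1 pgroup1 normal_refl.
  by split=> //; apply/derG1P.
have nsDG : D <| G by apply: der_normal.
pose p := pdiv #|D|.
have p_pr : prime p by rewrite pdiv_prime // cardG_gt1.
(* The p-part and the p'-part of [D] are normal in [G] and meet trivially, so one is trivial; it is
   the p'-part, as p divides |D|. *)
have pD : p.-group D.
  have nsO pi : 'O_pi(D) <| G := gFnormal_trans _ nsDG.
  have dO := nilpotent_pcoreC p (abelian_nil abD).
  have [_ _ _ tO] := dprodP dO.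
  case: (mono _ _ (nsO p) (nsO p^') tO) => O1; last first.
    by move: dO; rewrite O1 dprodg1 => <-; apply: pcore_pgroup.
  have p'D : p^'.-group D.
    by move: dO; rewrite O1 dprod1g => <-; apply: pcore_pgroup.
  have := pgroupP p'D p p_pr (pdiv_dvd _).
  by rewrite !inE eqxx.
have [P sylP] := Sylow_exists p G.
have [sPG pP _] := and3P sylP.
have sDP : D \subset P.
  by apply: subset_trans (pcore_max pD nsDG) (pcore_sub_Hall sylP).
have nsPG : P <| G := sub_der1_normal sDP sPG.
have abQ : abelian (G / P) := sub_der1_abelian sDP.
have /splitsP[K /complP[tiPK PK]] :=
  SchurZassenhaus_split (pHall_Hall sylP) nsPG.
have sKG : K \subset G by rewrite -PK mulG_subr.
have oPK : (#|P| * #|K|)%N = #|G| by rewrite -PK TI_cardMg.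
have nPK := subset_trans sKG (normal_norm nsPG).
have coPK : coprime #|P| #|K|.
  have /andP[_] := pHall_Hall sylP.
  by rewrite -divgS // -oPK mulKn.
(* The derived subgroup of [K] lies in [D], hence in the intersection of [P] and [K]. *)
have abK : abelian K.
  apply/derG1P/trivgP; rewrite -tiPK subsetI der_sub andbT.
  exact: subset_trans (dergS 1 sKG) sDP.
have P1 : 1 < #|P|.
  by rewrite (leq_trans _ (subset_leq_card sDP)) // cardG_gt1.
(* Since G = PK with [K] abelian, this subgroup is central in [G]; it meets [D] trivially. *)
have cKP1 : 'C_K(P) = 1.
  have cG : 'C_K(P) \subset 'Z(G).
    rewrite subsetI subIset ?sKG //= -PK centM subsetI subsetIr /=.
    by rewrite subIset // -/(abelian K) abK.
  have nsC : 'C_K(P) <| G := sub_center_normal cG.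
  have tiDC : D :&: 'C_K(P) = 1.
    by apply/trivgP; rewrite -tiPK setISS ?subsetIl.
  by case: (mono _ _ nsDG nsC tiDC) => // /eqP E; rewrite E in D1.
have oGP : #|G / P| = #|K|.
  by rewrite card_quotient ?normal_norm // -divgS // -oPK mulKn.
have [K1|K1] := leqP #|K| 1.
  exists D, p; split=> //; first exact: sub_der1_abelian.
  have -> : G = P.
    apply/val_inj/eqP; rewrite /= eq_sym eqEcard sPG -oPK.
    by rewrite -[leqRHS]muln1 leq_mul2l K1 orbT.
  exact: quotient_pgroup.
have ncPK : ~~ (K \subset 'C(P)).
  apply: contraTN K1 => cKP; rewrite -leqNgt.
  have /subset_leq_card : K \subset 'C_K(P) by rewrite subsetI subxx.
  by rewrite cKP1 cards1.
have ltPK : #|P| * #|K| < 42 by rewrite oPK.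
(* A non-abelian [P] has order at least p^3, hence 8, and would be centralized by [K]. *)
have abP : abelian P.
  apply: contraNT ncPK => nabP.
  have o8 : #|P| = 8.
    apply: (eq8_of_mul_lt42 p_pr pP _ K1) => //.
    by rewrite ltnNge; apply: contra nabP; apply: p2group_abelian.
  apply: (@nonabelian_card8 _ P D) => //.
  - exact: normalS sDP sPG nsDG.
  - by rewrite (subset_trans _ (_ : [~: G, G] \subset D)) // commgSS.
  exact: subset_trans sKG (normal_norm nsDG).
exists P, (pdiv #|K|); split=> //; first by rewrite pdiv_prime.
rewrite /pgroup oGP; apply: (prime_power_quotient_arith P1) => //.
move=> pr_P; have := index_cent_dvdn_pred pr_P nPK.
by rewrite cKP1 indexg1.
Qed.

(** * Subdirect products and induction on the order *)

Definition map_letter (G H : groupType) (n : nat) (f : G -> H)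
    (l : letter G n) : letter H n :=
  match l with Coef g => Coef (f g) | Var i => Var i | VarInv i => VarInv i end.

Lemma exp_sum_map (G H : groupType) (n : nat) (f : G -> H) (i : 'I_n)
    (w : word G n) :
  exp_sum i (map (map_letter f) w) = exp_sum i w.
Proof. by rewrite /exp_sum big_map; apply: eq_bigr => -[]. Qed.

Lemma eval_map (G H K : groupType) (n : nat) (f : G -> H) (g : H -> K)
    (h : 'I_n -> K) (w : word G n) :
  eval g h (map (map_letter f) w) = eval (g \o f) h w.
Proof. by rewrite /eval big_map; apply: eq_bigr => -[]. Qed.

Lemma metabelian_prod (H K : groupType) :
  metabelian H -> metabelian K -> metabelian (H * K)%type.
Proof.
move=> mH mK x y dx dy.
have d1 (z : (H * K)%type) : derived z -> derived (z.1 : H).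
  by apply: (@morph_derived _ _ (@fst H K)).
have d2 (z : (H * K)%type) : derived z -> derived (z.2 : K).
  by apply: (@morph_derived _ _ (@snd H K)).
by congr (_, _); [apply: mH; apply: d1 | apply: mK; apply: d2].
Qed.

Lemma metabelian_surj (G H : groupType) (f : G -> H) :
  {morph f : x y / x * y} -> (forall y, exists x, f x = y) ->
  metabelian G -> metabelian H.
Proof.
move=> fM fsurj mG; have fV := group_morphV fM.
have lift y : derived y -> exists2 x, derived x & f x = y.
  elim=> {y}[y z||_ _ _ [y dy <-] _ [z dz <-]|_ _ [y dy <-]].
  - have [[y' <-] [z' <-]] := (fsurj y, fsurj z).
    by exists [~ y', z']; [apply: derived_comm | rewrite !(fM, fV)].
  - by exists 1; [apply: derived_one | apply: group_morph1].
  - by exists (y * z); [apply: derived_mul | apply: fM].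
  by exists y^-1; [apply: derived_inv | apply: fV].
by move=> _ _ /lift[x dx <-] /lift[y dy <-]; rewrite /commute -!fM mG.
Qed.

(** Solutions of the two images pair up in the product of the two overgroups, in which [G] embeds as
    [f] and [g] are jointly injective. *)
Lemma solvable_subdirect (G H K : groupType) (f : G -> H) (g : G -> K) (n : nat)
    (w : word G n) :
    {morph f : x y / x * y} -> {morph g : x y / x * y} ->
    (forall x, f x = 1 -> g x = 1 -> x = 1) ->
    solvable_in_metabelian (map (map_letter f) w) ->
    solvable_in_metabelian (map (map_letter g) w) ->
  solvable_in_metabelian w.
Proof.
move=> fM gM fg1 [H' [f' [mH f'inj [h Eh]]]] [K' [g' [mK g'inj [k Ek]]]].
have f'M : {morph f' : x y / x * y} by apply: gmulfM.
have g'M : {morph g' : x y / x * y} by apply: gmulfM.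
pose F x : (H' * K')%type := (f' (f x), g' (g x)).
have FM : {morph F : x y / x * y} by move=> x y; rewrite /F fM f'M gM g'M.
pose Fm : {multiplicative G -> (H' * K')%type} :=
  HB.pack F (isMultiplicative.Build G (H' * K')%type F FM).
exists (H' * K')%type, Fm; split; first exact: metabelian_prod.
  move=> x y Exy.
  have F1 : F (x^-1 * y) = 1.
    by apply: (mulgI (F x)); rewrite -FM mulKVg mulg1.
  have [Ef Eg] : f' (f (x^-1 * y)) = 1 /\ g' (g (x^-1 * y)) = 1 by case: F1.
  suff xy1 : x^-1 * y = 1 by rewrite -[y](mulKVg x) xy1 mulg1.
  apply: fg1; [apply: f'inj | apply: g'inj].
    by rewrite Ef group_morph1.
  by rewrite Eg group_morph1.
exists (fun i => (h i, k i)).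
rewrite eval_map in Eh; rewrite eval_map in Ek.
rewrite [LHS]surjective_pairing; congr (_, _).
  by rewrite -[RHS]Eh; apply: (@eval_morph _ _ _ _ (@fst H' K')).
by rewrite -[RHS]Ek; apply: (@eval_morph _ _ _ _ (@snd H' K')).
Qed.

Lemma metabelian_abelian_der1 (G : finGroupType) :
  metabelian G -> abelian [set: G]^`(1).
Proof.
move=> mG; rewrite /derived_at /= /commutator abelian_gen.
apply/centsP=> _ /imset2P[x y _ _ ->] _ /imset2P[z t _ _ ->].
by apply: mG; apply: derived_comm.
Qed.

Lemma card_coset_of_lt (G : finGroupType) (N : {group G}) :
  N <| [set: G] -> N :!=: 1 -> #|{: coset_of N}| < #|G|.
Proof.
move=> nsN N1.
have -> : #|{: coset_of N}| = #|[set: G] / N|.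
  by rewrite -cardsT; congr #|pred_of_set _|; apply/setP=> x;
     rewrite !inE -[x]coset_reprK mem_quotient ?inE.
by rewrite -[in ltnRHS]cardsT ltn_quotient ?normal_sub.
Qed.

Lemma small_metabelian_solvable (G : finGroupType) :
    metabelian G -> #|G| < 42 ->
  forall (n : nat) (w : word G n), unimodular w -> solvable_in_metabelian w.
Proof.
have [m] := ubnP #|G|; elim: m G => // m IH G leGm mG ltG n w uw.
case: (boolP [exists N1 : {group G}, exists N2 : {group G},
    [&& N1 <| [set: G], N2 <| [set: G], N1 :&: N2 == 1,
        N1 :!=: 1 & N2 :!=: 1]]).
  case/existsP=> N1 /existsP[N2 /and5P[ns1 ns2 /eqP ti N11 N21]].
  have cosetM (N : {group G}) : N <| [set: G] -> {morph coset N : x y / x * y}.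
    by move=> nsN x y; rewrite morphM // (subsetP (normal_norm nsN)) ?inE.
  have quo (N : {group G}) : N <| [set: G] -> N :!=: 1 ->
      solvable_in_metabelian (map (map_letter (coset N)) w).
    move=> nsN nN; have lt := card_coset_of_lt nsN nN.
    (* Quotients by non-trivial normal subgroups are smaller and still metabelian, and exponent sums
       are unchanged. *)
    apply: IH.
    - exact: leq_trans lt leGm.
    - apply: metabelian_surj (cosetM N nsN) _ mG => y.
      by exists (repr y); apply: coset_reprK.
    - exact: ltn_trans lt ltG.
    by move=> p /uw[i pi]; exists i; rewrite exp_sum_map.
  apply: (solvable_subdirect (cosetM _ ns1) (cosetM _ ns2)); try exact: quo.
  have inN (N : {group G}) x : N <| [set: G] -> coset N x = 1 -> x \in N.
    by move=> nsN; apply: coset_idr; rewrite (subsetP (normal_norm nsN)) ?inE.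
  by move=> x x1 x2; apply/set1P; rewrite -[[set 1]]ti inE !inN.
rewrite negb_exists => /forallP mono.
have [||N1 N2 ns1 ns2 ti|A [p [p_pr nsA abA abQ pQ]]] :=
  @abelian_by_prime_power G [set: G]%G.
- exact: metabelian_abelian_der1.
- by rewrite cardsT.
- have := mono N1; rewrite negb_exists => /forallP/(_ N2).
  rewrite ns1 ns2 ti eqxx /= negb_and !negbK.
  by case/orP=> /eqP->; [left | right].
exact: (solvable_of_prime_power_quotient p_pr nsA).
Qed.

Local Close Scope group_scope.

Theorem proposition1 :
  [/\ metabelian [subg aff7_group],
      #|[subg aff7_group]| = 42,
      exists (n : nat) (w : word [subg aff7_group] n),
        unimodular w /\ ~ solvable_in_metabelian w
    & forall G : finGroupType, metabelian G -> #|G| < 42 ->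
        forall (n : nat) (w : word G n),
          unimodular w -> solvable_in_metabelian w].
Proof.
split; [exact: aff7_metabelian | exact: card_aff7 | exact: aff7_unsolvable |].
exact: small_metabelian_solvable.
Qed.
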